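(* There exist homeomorphisms $\Theta_{n,1}\in\mathcal{COMFORT}(\Delta_n)$, one for each $n\in\mathbb N$, such that, together with $\Theta_{n,0}:=\mathbf\Lambda_n(\phi_{n,0})\in\mathcal{COMFORT}(\Delta_n)$ for $n\in\mathbb N$ and $\Theta_{0,0}:=\Theta_{0,1}:=id_{\Delta_0}$, the following hold for every $n\in\mathbb N$. (1) For all $i,k\in\{0,1\}$ and all $j,p\in\{0,1,\dots,n\}$ with $j\le p$, the following equality of maps $\Delta_{n-1}\to\Delta_{n+1}$ holds: $$\langle id\rangle_{n+1,i,j}\circ\Theta_{n,i}\circ\langle id\rangle_{n,k,p}\circ\Theta_{n-1,k}\;=\;\langle id\rangle_{n+1,k,p+1}\circ\Theta_{n,k}\circ\langle id\rangle_{n,i,j}\circ\Theta_{n-1,i}.$$ (2) $\Theta_{n,1}$ restricts to a homeomorphism $$\clubsuit_{n,\frac1{2(n+1)}}\;\stackrel{\cong}{\longrightarrow}\;\clubsuit_{n,\frac1{2(n+1)+1}} .$$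
   Context: $\mathbb N=\{1,2,3,\dots\}$. $\Delta_n=\{(x_0,\dots,x_n)\in\mathbb R^{n+1}\mid 0\le x_j\le 1,\ \sum_{j=0}^n x_j=1\}$ is the standard simplex. For $n\in\mathbb N$, $i\in\{0,1\}$, $j\in\{0,\dots,n\}$, the map $\langle id\rangle_{n,i,j}:\Delta_{n-1}\to\Delta_n$ is $$\langle id\rangle_{n,i,j}(x_0,\dots,x_{n-1})=(y_0,\dots,y_{j-1},v,y_j,\dots,y_{n-1}),\quad v=\frac{i}{2(n+1)},\quad y_k=(1-v)x_k,$$ i.e. $v$ is inserted as the component with index $j$. For $\alpha\in[0,1]$, the $\alpha$-cross is $\clubsuit_{n,\alpha}=\{(x_0,\dots,x_n)\in\Delta_n\mid x_j=\alpha\text{ for at least one } j\}$. $\mathcal{COMFORT}(\Delta_n)$ is the set of all homeomorphisms $F:\Delta_n\to\Delta_n$ which respect permutations (if $F(x_0,\dots,x_n)=(y_0,\dots,y_n)$ then $F(x_{\vartheta(0)},\dots,x_{\vartheta(n)})=(y_{\vartheta(0)},\dots,y_{\vartheta(n)})$ for every permutation $\vartheta$ of $\{0,\dots,n\}$) and keep the order (if $x_{\vartheta(0)}\le\dots\le x_{\vartheta(n)}$ for a permutation $\vartheta$, then $y_{\vartheta(0)}\le\dots\le y_{\vartheta(n)}$ for $y=F(x)$). For an increasing homeomorphism $f$ of $[0,\frac1{n+1}]$, the map $\mathbf\Lambda_n(f):\Delta_n\to\Delta_n$ (an element of $\mathcal{COMFORT}(\Delta_n)$) sends $x$ to $y$,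 defined as follows. Choose a permutation $\vartheta$ and $r\in\{0,\dots,n\}$ with $x_{\vartheta(0)}\le\dots\le x_{\vartheta(r)}\le\frac1{n+1}<x_{\vartheta(r+1)}\le\dots\le x_{\vartheta(n)}$. Put $y_{\vartheta(i)}:=f(x_{\vartheta(i)})$ for $0\le i\le r$. If $r<n$, put $D:=\sum_{i=0}^r(x_{\vartheta(i)}-y_{\vartheta(i)})$, $\delta:=D\big/\sum_{i=r+1}^n(x_{\vartheta(i)}-\frac1{n+1})$, and $y_{\vartheta(i)}:=x_{\vartheta(i)}+\delta\,(x_{\vartheta(i)}-\frac1{n+1})$ for $r+1\le i\le n$. $\phi_{n,0}$ is the increasing homeomorphism of $[0,\frac1{n+1}]$ whose graph is the polygon (piecewise linear interpolation) through $(0,0)$, $\big(\frac1{2(n+1)},\frac1{2(n+2)}\big)$, $\big(\frac1{n+1},\frac1{n+1}\big)$. *)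

(* Defs.v *)
From HB Require Import structures.
From mathcomp Require Import all_boot all_order all_algebra all_fingroup.
From mathcomp Require Import all_classical all_reals all_analysis.

Set Implicit Arguments.
Unset Strict Implicit.
Unset Printing Implicit Defensive.

Import Order.TTheory GRing.Theory Num.Theory.
Import numFieldNormedType.Exports.

Local Open Scope classical_set_scope.
Local Open Scope ring_scope.

(* Maps between subsets of R^d are represented by total functions on row
   vectors; only their values on the relevant subset are ever constrained. *)

Definition homeomorphism_on (T U : topologicalType) (A : set T) (B : set U)
    (f : T -> U) : Prop :=
  exists g : U -> T,
    [/\ set_fun A B f /\ set_fun B A g,
        {in A, cancel f g} /\ {in B, cancel g f},
        {within A, continuous f} & {within B, continuous g}].

Section Simplex.
Variable R : realType.

Definition simplex (n : nat) : set 'rV[R]_n.+1 :=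
  [set x | (forall j, 0 <= x 0 j <= 1) /\ \sum_j x 0 j = 1].

Definition cross (n : nat) (alpha : R) : set 'rV[R]_n.+1 :=
  [set x | simplex x /\ exists j, x 0 j = alpha].

(* <id>_{n,i,j} : Delta_{n-1} -> Delta_n, used for n >= 1 only; the domain
   Delta_{n-1} lies in R^n. *)
Definition insert_coord (n : nat) (i : bool) (j : 'I_n.+1) (x : 'rV[R]_n) :
    'rV[R]_n.+1 :=
  let v := i%:R / (2 * n.+1%:R) in
  \row_k (if unlift j k is Some l then (1 - v) * x 0 l else v).

Definition respects_permutations (n : nat) (F : 'rV[R]_n.+1 -> 'rV[R]_n.+1) :=
  forall (s : 'S_n.+1) (x : 'rV[R]_n.+1), simplex x ->
    F (col_perm s x) = col_perm s (F x).

Definition sorted_by (n : nat) (s : 'S_n.+1) (x : 'rV[R]_n.+1) : bool :=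
  [forall a : 'I_n.+1, forall b : 'I_n.+1, (a <= b)%N ==> (x 0 (s a) <= x 0 (s b))].

Definition keeps_order (n : nat) (F : 'rV[R]_n.+1 -> 'rV[R]_n.+1) :=
  forall (s : 'S_n.+1) (x : 'rV[R]_n.+1), simplex x ->
    sorted_by s x -> sorted_by s (F x).

Definition comfort (n : nat) (F : 'rV[R]_n.+1 -> 'rV[R]_n.+1) : Prop :=
  [/\ homeomorphism_on (@simplex n) (@simplex n) F,
      respects_permutations F & keeps_order F].

(* (s, r) is an allowed choice for x when
   x_{s 0} <= ... <= x_{s r} <= 1/(n+1) < x_{s (r+1)} <= ... <= x_{s n}. *)
Definition Lambda_choice (n : nat) (x : 'rV[R]_n.+1)
    (sr : 'S_n.+1 * 'I_n.+1) : bool :=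
  [&& sorted_by sr.1 x,
      x 0 (sr.1 sr.2) <= n.+1%:R^-1
    & [forall k : 'I_n.+1, (sr.2 < k)%N ==> (n.+1%:R^-1 < x 0 (sr.1 k))]].

Definition Lambda_with (n : nat) (f : R -> R) (x : 'rV[R]_n.+1)
    (sr : 'S_n.+1 * 'I_n.+1) : 'rV[R]_n.+1 :=
  let: (s, r) := sr in
  let D := \sum_(i < n.+1 | (i <= r)%N) (x 0 (s i) - f (x 0 (s i))) in
  let delta :=
    D / \sum_(i < n.+1 | (r < i)%N) (x 0 (s i) - n.+1%:R^-1) in
  \row_j (if ((s^-1)%g j <= r)%N then f (x 0 j)
          else x 0 j + delta * (x 0 j - n.+1%:R^-1)).

(* The result does not depend on the choice picked.  Every point of the
   simplex admits a choice, so the default is only used outside the simplex. *)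
Definition Lambda (n : nat) (f : R -> R) (x : 'rV[R]_n.+1) : 'rV[R]_n.+1 :=
  if [pick sr | Lambda_choice x sr] is Some sr then Lambda_with f x sr else x.

Definition line_through (p q : R * R) (t : R) : R :=
  p.2 + (q.2 - p.2) / (q.1 - p.1) * (t - p.1).

Definition phi0 (n : nat) (t : R) : R :=
  let a := (2 * n.+1%:R)^-1 in
  let b := (2 * n.+2%:R)^-1 in
  let c := n.+1%:R^-1 in
  if t <= a then line_through (0, 0) (a, b) t
  else line_through (a, b) (c, c) t.

Definition Theta (Theta1 : forall n : nat, 'rV[R]_n.+1 -> 'rV[R]_n.+1)
    (n : nat) (i : bool) : 'rV[R]_n.+1 -> 'rV[R]_n.+1 :=
  if n == 0%N then id
  else if i then Theta1 n
  else Lambda (phi0 n).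

End Simplex.

Arguments simplex {R} n.
Arguments cross {R} n alpha.
Arguments insert_coord {R} n i j x.
Arguments Lambda {R} n f x.
Arguments phi0 {R} n t.
Arguments Theta {R} Theta1 n i.

(* Main.v *)
(* Call a homeomorphism of a simplex (a, a')-tame if it is in COMFORT, preserves the
   order of any two coordinates, and multiplies by a'/a every coordinate that is at
   most a; tameness is stable under composition.  With a_n = 1/(2(n+1)) and
   a'_n = 1/(2(n+1)+1), Theta_{n,0} is (a_n, a_{n+1})-tame, and it suffices that
   Theta_{n,1} be (a_n, a'_n)-tame and that
     Theta_{n,1} (ins_0 (Theta_{n-1,0} x)) = ins_0 (M (Theta_{n-1,1} x)),
   where M removes the inserted coordinate a_n after Theta_{n,0} and rescales.
   This prescribes Theta_{n,1} on the boundary of the simplex by the map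
   M o Theta_{n-1,1} o Theta_{n-1,0}^-1, which is (a_n, a'_n)-tame because the
   levels a_n -> a_{n-1} -> a'_{n-1} -> a'_n match.  So everything reduces to
   extending a tame map G from the boundary to the simplex, tamely.

   For x with least coordinate m, subtract m from all coordinates and restore the
   sum to 1 by stretching only the excess above the level max(a-m, 0); this gives
   a boundary point z.  The pair (m, z) determines x, and the extension sends it
   to the point with the pair (m', G z), m' being the image of m under the polygon
   through (0,0), (a,a'), (b,b), where b is the barycentric value.  Coordinates
   below a are only translated, so they are still multiplied by a'/a, and the
   inverse is the same construction applied to G^-1. *)
Require Import Defs.
From HB Require Import structures.
From mathcomp Require Import all_boot all_order all_algebra all_fingroup.
From mathcomp Require Import all_classical all_reals all_analysis.
From mathcomp Require Import ring lra zify.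
Import Order.TTheory GRing.Theory Num.Theory.
Import numFieldNormedType.Exports.
Local Open Scope classical_set_scope.
Local Open Scope ring_scope.

Set Implicit Arguments.
Unset Strict Implicit.
Unset Printing Implicit Defensive.

(** * Truncation and piecewise linear maps *)

Section Cutoff.
Context {R : realType}.
Implicit Types (l a b t u lam : R).

Definition lo l t := Num.min t l.
Definition hi l t := t - lo l t.

Lemma lohi l t : lo l t + hi l t = t.
Proof. by rewrite /hi addrC subrK. Qed.

Lemma lo_id l t : t <= l -> lo l t = t.
Proof. by move=> tl; apply/min_idPl. Qed.

Lemma lo_cut l t : l <= t -> lo l t = l.
Proof. by move=> lt; apply/min_idPr. Qed.

Lemma hi_le l t : t <= l -> hi l t = 0.
Proof. by move=> tl; rewrite /hi lo_id// subrr. Qed.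

Lemma hi_ge l t : l <= t -> hi l t = t - l.
Proof. by move=> tl; rewrite /hi lo_cut. Qed.

Lemma hi_ge0 l t : 0 <= hi l t.
Proof. by rewrite /hi /lo subr_ge0 ge_min lexx. Qed.

Lemma lo_le l t : lo l t <= l.
Proof. by rewrite /lo ge_min lexx orbT. Qed.

Lemma lo_ge0 l t : 0 <= l -> 0 <= t -> 0 <= lo l t.
Proof. by move=> l0 t0; rewrite /lo le_min l0 t0. Qed.

Lemma lo_mono l t u : t <= u -> lo l t <= lo l u.
Proof. by move=> tu; rewrite /lo le_min !ge_min tu lexx orbT. Qed.

Lemma hi_mono l t u : t <= u -> hi l t <= hi l u.
Proof.
move=> tu; case: (leP t l) => tl; case: (leP u l) => ul.
- by rewrite !hi_le.
- by rewrite (hi_le tl) hi_ge0.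
- by have := lt_le_trans tl (le_trans tu ul); rewrite ltxx.
- by rewrite !hi_ge ?(ltW tl) ?(ltW ul)// lerB.
Qed.

Lemma lo_glue l t lam : 0 <= lam -> lo l (lo l t + lam * hi l t) = lo l t.
Proof.
move=> lam0; case: (leP t l) => tl.
  by rewrite hi_le// mulr0 addr0 lo_id// lo_le.
rewrite (lo_cut (ltW tl)) lo_cut// lerDl mulr_ge0// hi_ge0//.
Qed.

Lemma hi_glue l t lam : 0 <= lam -> hi l (lo l t + lam * hi l t) = lam * hi l t.
Proof. by move=> lam0; rewrite {1}/hi lo_glue// addrC addKr. Qed.

(* Graph: the polygon through (0, 0), (a, a') and (b, b), for 0 < a < b. *)
Definition pl (a a' b t : R) := a' / a * lo a t + (b - a') / (b - a) * hi a t.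

Lemma pl_lo a a' b t : 0 < a < b -> 0 < a' < b -> lo a' (pl a a' b t) = a' / a * lo a t.
Proof.
move=> /andP[a0 ab] /andP[a'0 a'b]; have c0 : 0 < a' / a by apply: divr_gt0.
have d0 : 0 <= (b - a') / (b - a) by rewrite divr_ge0// subr_ge0 ltW.
rewrite /pl; case: (leP t a) => ta.
  rewrite hi_le// mulr0 addr0 lo_id// lo_id//.
  by rewrite mulrAC ler_pdivrMr// ler_pM2l.
rewrite (lo_cut (ltW ta)) divfK ?gt_eqF// lo_cut// lerDl mulr_ge0// hi_ge0//.
Qed.

Lemma plK a a' b : 0 < a < b -> 0 < a' < b -> cancel (pl a a' b) (pl a' a b).
Proof.
move=> aP a'P t; rewrite {1}/pl /hi pl_lo// /pl.
have [/andP[a0 ab] /andP[a'0 a'b]] := (aP, a'P).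
rewrite -[RHS](lohi a); move: (lo a t) (hi a t) => x y.
by field; rewrite !gt_eqF// subr_gt0.
Qed.

Lemma pl_small a a' b t : t <= a -> pl a a' b t = a' / a * t.
Proof. by move=> ta; rewrite /pl hi_le// lo_id// mulr0 addr0. Qed.

Lemma pl_big a a' b t : a != 0 -> a <= t ->
  pl a a' b t = a' + (b - a') / (b - a) * (t - a).
Proof. by move=> a0 ta; rewrite /pl hi_ge// lo_cut// divfK. Qed.

Lemma pl0 a a' b : 0 <= a -> pl a a' b 0 = 0.
Proof. by move=> a0; rewrite pl_small// mulr0. Qed.

Lemma plb a a' b : 0 < a < b -> pl a a' b b = b.
Proof.
move=> /andP[a0 ab]; rewrite pl_big ?gt_eqF ?(ltW ab)//.
by rewrite divfK ?gt_eqF ?subr_gt0// addrC subrK.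
Qed.

Lemma pl_mono a a' b t u : 0 < a < b -> 0 < a' < b ->
  t <= u -> pl a a' b t <= pl a a' b u.
Proof.
move=> /andP[a0 ab] /andP[a'0 a'b] tu.
apply: lerD; apply: ler_wpM2l; rewrite ?lo_mono ?hi_mono//.
  by rewrite divr_ge0// ltW.
by rewrite divr_ge0// subr_ge0 ltW.
Qed.

Lemma pl_smono a a' b t u : 0 < a < b -> 0 < a' < b ->
  t < u -> pl a a' b t < pl a a' b u.
Proof.
move=> aP a'P tu; rewrite lt_neqAle pl_mono ?ltW// andbT.
by apply/eqP => /(can_inj (plK aP a'P)) tuE; rewrite tuE ltxx in tu.
Qed.

End Cutoff.

Section Rescaling.
Context {R : realType} {n : nat}.
Implicit Types (l sigma tau : R) (w : 'rV[R]_n) (s : 'S_n).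

(* [rescale] stretches the excess over [l] by the factor that makes the coordinates
   sum to [sigma]; when there is no excess, the junk slope x / 0 = 0 is harmless. *)
Definition slope l sigma w :=
  (sigma - \sum_k lo l (w 0 k)) / \sum_k hi l (w 0 k).

Definition rescale l sigma w : 'rV[R]_n :=
  \row_j (lo l (w 0 j) + slope l sigma w * hi l (w 0 j)).

Lemma rescale_sum l sigma w : \sum_k hi l (w 0 k) != 0 ->
  \sum_j rescale l sigma w 0 j = sigma.
Proof.
move=> h0; under eq_bigr do rewrite mxE.
by rewrite big_split/= -mulr_sumr /slope divfK// addrC subrK.
Qed.

Lemma rescale_id l w : rescale l (\sum_k w 0 k) w = w.
Proof.
apply/rowP => j; rewrite mxE -[RHS](lohi l); congr (_ + _).
have -> : slope l (\sum_k w 0 k) w = (\sum_k hi l (w 0 k)) / \sum_k hi l (w 0 k).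
  by rewrite /slope -sumrB.
have [h0|h0] := eqVneq (\sum_k hi l (w 0 k)) 0; last by rewrite divff// mul1r.
rewrite h0 mul0r mul0r; apply/esym.
by apply: (psumr_eq0P _ h0) => // k _; exact: hi_ge0.
Qed.

Lemma rescaleK l sigma tau w : 0 < slope l sigma w ->
  rescale l tau (rescale l sigma w) = rescale l tau w.
Proof.
move=> s0; apply/rowP => j; rewrite !mxE lo_glue ?ltW// hi_glue ?ltW//.
congr (_ + _); rewrite mulrA; congr (_ * _).
have -> : slope l tau (rescale l sigma w) =
    (tau - \sum_k lo l (w 0 k)) / (slope l sigma w * \sum_k hi l (w 0 k)).
  rewrite {1}/slope mulr_sumr; congr ((_ - _) / _).
    by apply: eq_bigr => k _; rewrite mxE lo_glue ?ltW.
  by apply: eq_bigr => k _; rewrite mxE hi_glue ?ltW.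
move: (slope l sigma w) s0 => q q0.
by rewrite [X in _ / X]mulrC invfM mulrA divfK ?gt_eqF.
Qed.

Lemma rescale_small l sigma w j : w 0 j <= l -> rescale l sigma w 0 j = w 0 j.
Proof. by move=> wl; rewrite mxE hi_le// mulr0 addr0 lo_id. Qed.

Lemma rescale_mono l sigma w i j : 0 <= slope l sigma w ->
  w 0 i <= w 0 j -> rescale l sigma w 0 i <= rescale l sigma w 0 j.
Proof.
by move=> s0 wij; rewrite !mxE lerD ?lo_mono// ler_wpM2l// hi_mono.
Qed.

Lemma rescale_ge l sigma w j : 0 <= slope l sigma w ->
  lo l (w 0 j) <= rescale l sigma w 0 j.
Proof. by move=> s0; rewrite mxE lerDl mulr_ge0// hi_ge0. Qed.

Lemma rescale_perm l sigma w s :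
  rescale l sigma (col_perm s w) = col_perm s (rescale l sigma w).
Proof.
apply/rowP => j; rewrite !mxE /slope.
congr (_ + (_ - _) / _ * _); rewrite [RHS](reindex_inj (@perm_inj _ s))/=;
  by apply: eq_bigr => k _; rewrite mxE.
Qed.

End Rescaling.

Section Convergence.
Context {R : realType} {T : Type} (F : set_system T) {FF : Filter F}.

Lemma cvg_rowP n (u : T -> 'rV[R]_n) (v : 'rV[R]_n) :
  u t @[t --> F] --> v <-> forall j, u t 0 j @[t --> F] --> v 0 j.
Proof.
split=> [uv j|uv].
  exact: (continuous_cvg FF (@coord_continuous R 1 n 0 j v) uv).
apply/cvg_ballP => e e0.
have : \forall t \near F, forall j, ball (v 0 j) e (u t 0 j).
  by apply: filter_forall => j; apply: (cvg_ball (uv j)).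
apply: filterS => t ut; split=> // i j; rewrite (ord1 i); exact: ut.
Qed.

Lemma cvg_finsum (I : finType) (f : I -> T -> R) (a : I -> R) :
  (forall i, f i t @[t --> F] --> a i) ->
  \sum_i f i t @[t --> F] --> \sum_i a i.
Proof. by move=> fa; apply: cvg_big => //; exact: add_continuous. Qed.

Lemma cvg_lo (l u : T -> R) (l0 u0 : R) :
  l t @[t --> F] --> l0 -> u t @[t --> F] --> u0 ->
  lo (l t) (u t) @[t --> F] --> lo l0 u0.
Proof.
move=> ll uu.
apply: (@continuous2_cvg T R R R F FF u l (fun x y : R => Num.min x y) u0 l0) => //.
exact: (@min_continuous _ R (u0, l0)).
Qed.

Lemma cvg_hi (l u : T -> R) (l0 u0 : R) :
  l t @[t --> F] --> l0 -> u t @[t --> F] --> u0 ->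
  hi (l t) (u t) @[t --> F] --> hi l0 u0.
Proof. by move=> ll uu; apply: cvgB => //; exact: cvg_lo. Qed.

Lemma cvg_pl (a a' b : R) (u : T -> R) (u0 : R) :
  u t @[t --> F] --> u0 -> pl a a' b (u t) @[t --> F] --> pl a a' b u0.
Proof.
move=> uu; apply: cvgD; apply: cvgM; try exact: cvg_cst.
  by apply: cvg_lo => //; exact: cvg_cst.
by apply: cvg_hi => //; exact: cvg_cst.
Qed.

Lemma cvg_rescale n (l sigma : T -> R) (w : T -> 'rV[R]_n)
    (l0 sigma0 : R) (w0 : 'rV[R]_n) :
  \sum_k hi l0 (w0 0 k) != 0 ->
  l t @[t --> F] --> l0 -> sigma t @[t --> F] --> sigma0 ->
  w t @[t --> F] --> w0 ->
  rescale (l t) (sigma t) (w t) @[t --> F] --> rescale l0 sigma0 w0.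
Proof.
move=> h0 ll ss /cvg_rowP ww; apply/cvg_rowP => j.
under eq_fun do rewrite mxE; rewrite mxE.
apply: cvgD; first exact: cvg_lo.
apply: cvgM; last exact: cvg_hi.
apply: cvgM.
  by apply: cvgB => //; apply: cvg_finsum => k; apply: cvg_lo.
by apply: cvgV => //; apply: cvg_finsum => k; apply: cvg_hi.
Qed.

Lemma cvg_withincomp (U V : topologicalType) (A : set U) (f : U -> V)
    (u : T -> U) (u0 : U) :
  {within A, continuous f} -> A u0 -> (\forall t \near F, A (u t)) ->
  u t @[t --> F] --> u0 -> f (u t) @[t --> F] --> f u0.
Proof.
move=> /subspace_continuousP cf Au0 Au uu0.
apply: cvg_trans (cf u0 Au0) => P; rewrite /= /nbhs /= => fP.
have H := uu0 _ fP.
by apply: filterS2 Au H => t Aut; apply.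
Qed.

End Convergence.

(** * Tame maps *)

Section Tame.
Context {R : realType}.
Implicit Types (n : nat) (a b c v : R).

Lemma simplexP n (x : 'rV[R]_n.+1) :
  (forall j, 0 <= x 0 j) -> \sum_j x 0 j = 1 -> simplex n x.
Proof.
move=> x0 x1; split=> // j; rewrite x0/= -x1 (bigD1 j)//= lerDl.
exact: sumr_ge0.
Qed.

Lemma simplex_ge0 n (x : 'rV[R]_n.+1) j : simplex n x -> 0 <= x 0 j.
Proof. by move=> [/(_ j)/andP[]]. Qed.

Lemma simplex_perm n (s : 'S_n.+1) (x : 'rV[R]_n.+1) :
  simplex n x -> simplex n (col_perm s x).
Proof.
move=> [x0 x1]; apply: simplexP => [j|]; first by rewrite mxE; case/andP: (x0 (s j)).
by rewrite -x1 [RHS](reindex_inj (@perm_inj _ s))/=; apply: eq_bigr => j _; rewrite mxE.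
Qed.

Definition tame n (a a' : R) (F : 'rV[R]_n.+1 -> 'rV[R]_n.+1) : Prop :=
  [/\ set_fun (simplex n) (simplex n) F,
      {within simplex n, continuous F},
      respects_permutations F,
      forall x, simplex n x -> forall i j, x 0 i <= x 0 j -> F x 0 i <= F x 0 j
    & forall x, simplex n x -> forall j, x 0 j <= a -> F x 0 j = a' / a * x 0 j].

Definition tame_iso n (a a' : R) (F F' : 'rV[R]_n.+1 -> 'rV[R]_n.+1) : Prop :=
  [/\ tame a a' F, tame a' a F',
      forall x, simplex n x -> F' (F x) = x
    & forall x, simplex n x -> F (F' x) = x].

Lemma tame_iso_sym n a a' (F F' : 'rV[R]_n.+1 -> 'rV[R]_n.+1) :
  tame_iso a a' F F' -> tame_iso a' a F' F.
Proof. by case. Qed.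

Lemma tame_level n a a' (F : 'rV[R]_n.+1 -> 'rV[R]_n.+1) x j :
  0 < a -> tame a a' F -> simplex n x -> x 0 j = a -> F x 0 j = a'.
Proof.
move=> a0 [_ _ _ _ Fa] Dx xa; rewrite Fa// ?xa//.
by rewrite divfK// gt_eqF.
Qed.

Lemma tame_zero n a a' (F : 'rV[R]_n.+1 -> 'rV[R]_n.+1) x j :
  0 <= a -> tame a a' F -> simplex n x -> x 0 j = 0 -> F x 0 j = 0.
Proof. by move=> a0 [_ _ _ _ Fa] Dx xa; rewrite Fa// ?xa// mulr0. Qed.

Lemma tame_comp n a b c (F G : 'rV[R]_n.+1 -> 'rV[R]_n.+1) :
  0 < a -> 0 < b -> tame a b F -> tame b c G -> tame a c (G \o F).
Proof.
move=> a0 b0 [FD Fc Fs Fm Fa] [GD Gc Gs Gm Ga]; split.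
- by move=> x Dx; apply/GD/FD.
- apply/subspace_continuousP => x Dx.
  apply: (cvg_withincomp Gc); first exact: FD.
    by rewrite near_withinE; apply: nearW => y; exact: FD.
  by move/subspace_continuousP : Fc; apply.
- by move=> s x Dx /=; rewrite Fs// Gs//; exact: FD.
- by move=> x Dx i j xij /=; apply: Gm; [exact: FD|exact: Fm].
- move=> x Dx j xa /=; have FxE := Fa _ Dx _ xa.
  rewrite Ga//; last first.
  + by rewrite FxE mulrAC ler_pdivrMr// ler_pM2l.
  + exact: FD.
  by rewrite FxE !mulrA divfK// gt_eqF.
Qed.

Lemma tame_iso_comp n a b c (F F' G G' : 'rV[R]_n.+1 -> 'rV[R]_n.+1) :
  0 < a -> 0 < b -> 0 < c -> tame_iso a b F F' -> tame_iso b c G G' ->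
  tame_iso a c (G \o F) (F' \o G').
Proof.
move=> a0 b0 c0 [tF tF' FK F'K] [tG tG' GK G'K]; split.
- exact: tame_comp tF tG.
- exact: tame_comp tG' tF'.
- move=> x Dx /=; rewrite GK ?FK//; by case: tF => FD _ _ _ _; apply: FD.
- move=> x Dx /=; rewrite F'K ?G'K//; by case: tG' => GD _ _ _ _; apply: GD.
Qed.

Lemma tame_iso_comfort n a a' (F F' : 'rV[R]_n.+1 -> 'rV[R]_n.+1) :
  tame_iso a a' F F' -> comfort F.
Proof.
move=> [[FD Fc Fs Fm _] [FD' Fc' _ _ _] FK F'K]; split=> //.
- exists F'; split=> //; split=> x; rewrite inE => Dx; [exact: FK|exact: F'K].
- move=> s x Dx /forallP xs; apply/forallP => i; apply/forallP => j.
  apply/implyP => ij; apply: Fm => //.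
  by have /forallP/(_ j)/implyP := xs i; apply.
Qed.

Lemma tame_iso_cross n a a' (F F' : 'rV[R]_n.+1 -> 'rV[R]_n.+1) :
  0 < a -> 0 < a' -> tame_iso a a' F F' ->
  homeomorphism_on (cross n a) (cross n a') F.
Proof.
move=> a0 a'0 [tF tF' FK F'K].
have [[FD Fc _ _ _] [FD' Fc' _ _ _]] := (tF, tF').
exists F'; split.
- split=> x [Dx [j xj]]; split; rewrite ?FD ?FD'//; try exact: FD; try exact: FD'.
    by exists j; exact: tame_level xj.
  by exists j; exact: tame_level xj.
- by split=> x; rewrite inE => -[Dx _]; [exact: FK|exact: F'K].
- by apply: continuous_subspaceW Fc => x [].
- by apply: continuous_subspaceW Fc' => x [].
Qed.

Lemma simplex0 (x : 'rV[R]_1) : simplex 0 x -> x = const_mx 1.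
Proof.
by move=> [_]; rewrite big_ord1 => x1; apply/rowP => j; rewrite ord1 x1 mxE.
Qed.

Lemma tame_iso_id0 a a' : a < 1 -> a' < 1 -> tame_iso a a' (@id 'rV[R]_1) id.
Proof.
have H c c' : c < 1 -> tame c c' (@id 'rV[R]_1).
  move=> c1; split=> //.
    by apply/subspace_continuousP => x Dx; exact: cvg_within.
  move=> x /simplex0 -> j; rewrite mxE => /le_lt_trans/(_ c1).
  by rewrite ltxx.
by move=> a1 a'1; split=> //; exact: H.
Qed.

End Tame.

Section InsertRemove.
Context {R : realType} {n : nat}.
Implicit Types (v : R) (i j : 'I_n.+1) (x : 'rV[R]_n) (y : 'rV[R]_n.+1).

Definition ins v j x : 'rV[R]_n.+1 :=
  \row_k (if unlift j k is Some l then (1 - v) * x 0 l else v).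

Definition rem v j y : 'rV[R]_n := \row_l ((1 - v)^-1 * y 0 (lift j l)).

Lemma ins_at v j x : ins v j x 0 j = v.
Proof. by rewrite mxE unlift_none. Qed.

Lemma ins_lift v j x l : ins v j x 0 (lift j l) = (1 - v) * x 0 l.
Proof. by rewrite mxE liftK. Qed.

Lemma insK v j x : v < 1 -> rem v j (ins v j x) = x.
Proof.
move=> v1; apply/rowP => l; rewrite mxE ins_lift mulKf//.
by rewrite subr_eq0 gt_eqF.
Qed.

Lemma remK v j y : v < 1 -> y 0 j = v -> ins v j (rem v j y) = y.
Proof.
move=> v1 yj; apply/rowP => k; rewrite mxE; case: unliftP => [l|] -> //.
by rewrite mxE mulVKf// subr_eq0 gt_eqF.
Qed.

Lemma ins_perm v i j (s : 'S_n) x :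
  ins v i (col_perm s x) = col_perm (lift_perm i j s) (ins v j x).
Proof.
apply/rowP => k; rewrite [RHS]mxE; case: (unliftP i k) => [l|] ->.
  by rewrite ins_lift mxE lift_perm_lift ins_lift.
by rewrite lift_perm_id !ins_at.
Qed.

Lemma rem_perm v i j (s : 'S_n) y :
  rem v i (col_perm (lift_perm i j s) y) = col_perm s (rem v j y).
Proof. by apply/rowP => l; rewrite !mxE lift_perm_lift. Qed.

Lemma lift_perm_surj (s : 'S_n.+1) i : exists t : 'S_n, s = lift_perm i (s i) t.
Proof.
have H l : {k | s (lift i l) = lift (s i) k}.
  case: (unliftP (s i) (s (lift i l))) => [k ->|/perm_inj/eqP]; first by exists k.
  by rewrite eq_sym (negbTE (neq_lift _ _)).
have Hinj : injective (fun l => sval (H l)).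
  move=> l l' ll'; apply: (@lift_inj _ i); apply: (@perm_inj _ s).
  by rewrite (svalP (H l)) (svalP (H l')) ll'.
exists (perm Hinj); apply/permP => k.
case: (unliftP i k) => [l|] ->; last by rewrite lift_perm_id.
by rewrite lift_perm_lift permE -(svalP (H l)).
Qed.

Lemma cvg_ins (T : Type) (F : set_system T) {FF : Filter F} v j (x : T -> 'rV[R]_n) x0 :
  x t @[t --> F] --> x0 -> ins v j (x t) @[t --> F] --> ins v j x0.
Proof.
move=> /cvg_rowP xx; apply/cvg_rowP => k; case: (unliftP j k) => [l|] ->.
  under eq_fun do rewrite ins_lift; rewrite ins_lift.
  by apply: cvgM => //; exact: cvg_cst.
by under eq_fun do rewrite ins_at; rewrite ins_at; exact: cvg_cst.
Qed.

Lemma cvg_rem (T : Type) (F : set_system T) {FF : Filter F} v j (y : T -> 'rV[R]_n.+1) y0 :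
  y t @[t --> F] --> y0 -> rem v j (y t) @[t --> F] --> rem v j y0.
Proof.
move=> /cvg_rowP yy; apply/cvg_rowP => l.
under eq_fun do rewrite mxE; rewrite mxE.
by apply: cvgM => //; exact: cvg_cst.
Qed.

End InsertRemove.

Section Slice.
Context {R : realType} {n : nat}.
Implicit Types (v a : R) (j : 'I_n.+2) (x : 'rV[R]_n.+1) (y : 'rV[R]_n.+2).

Lemma ins_simplex v j x : 0 <= v < 1 -> simplex n x -> simplex n.+1 (ins v j x).
Proof.
move=> /andP[v0 v1] [x0 x1]; apply: simplexP => [k|].
  case: (unliftP j k) => [l|] ->; rewrite ?ins_at// ins_lift mulr_ge0//.
    by rewrite subr_ge0 ltW.
  by case/andP: (x0 l).
rewrite (bigD1_ord j)//= ins_at; under eq_bigr do rewrite ins_lift.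
by rewrite -mulr_sumr x1 mulr1 addrC subrK.
Qed.

Lemma rem_simplex v j y : v < 1 -> y 0 j = v -> simplex n.+1 y -> simplex n (rem v j y).
Proof.
move=> v1 yj [y0 y1]; apply: simplexP => [l|].
  rewrite mxE mulr_ge0//; first by rewrite invr_ge0 subr_ge0 ltW.
  by case/andP: (y0 (lift j l)).
under eq_bigr do rewrite mxE.
rewrite -mulr_sumr.
have -> : \sum_(l < n.+1) y 0 (lift j l) = 1 - v.
  by apply: (addrI v); rewrite [RHS]addrC subrK -y1 [RHS](bigD1_ord j)//= yj.
by rewrite mulVf// subr_eq0 gt_eqF.
Qed.

Definition slice v v' j (F : 'rV[R]_n.+2 -> 'rV[R]_n.+2) x : 'rV[R]_n.+1 :=
  rem v' j (F (ins v j x)).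

End Slice.

Section SliceTheory.
Context {R : realType} {n : nat}.
Implicit Types (v a : R) (i j : 'I_n.+2) (F : 'rV[R]_n.+2 -> 'rV[R]_n.+2).

Lemma ins_slice v v' j F x : v' < 1 ->
  F (ins v j x) 0 j = v' -> ins v' j (slice v v' j F x) = F (ins v j x).
Proof. by move=> v'1 Fv; rewrite remK. Qed.

Lemma slice_index v v' i j F (x : 'rV[R]_n.+1) : 0 <= v < 1 -> simplex n x ->
  respects_permutations F -> slice v v' i F x = slice v v' j F x.
Proof.
move=> v1 Dx Fs; rewrite /slice -[x in LHS]col_perm1 (ins_perm v i j) Fs.
  by rewrite rem_perm col_perm1.
exact: ins_simplex.
Qed.

Lemma slice_tame a a' j F : 0 < a < 1 -> 0 < a' < 1 ->
  tame a a' F -> tame (a / (1 - a)) (a' / (1 - a')) (slice a a' j F).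
Proof.
move=> /andP[a0 a1] /andP[a'0 a'1] tF; have [FD Fc Fs Fm Fa] := tF.
have iD x : simplex n x -> simplex n.+1 (ins a j x).
  by move=> Dx; apply: ins_simplex => //; rewrite ltW.
have aS : 0 < 1 - a by rewrite subr_gt0.
have a'S : 0 < 1 - a' by rewrite subr_gt0.
split.
- move=> x Dx; apply: rem_simplex => //; last exact/FD/iD.
  by apply: (tame_level _ tF) => //; [exact: iD|rewrite ins_at].
- apply/subspace_continuousP => x Dx; apply: cvg_rem.
  apply: (cvg_withincomp Fc); first exact: iD.
    by rewrite near_withinE; apply: nearW => y; exact: iD.
  by apply: cvg_ins; exact: cvg_within.
- move=> s x Dx.
  by rewrite {1}/slice (ins_perm a j j) Fs ?rem_perm//; exact: iD.
- move=> x Dx k l xkl; rewrite !mxE ler_pM2l ?invr_gt0//.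
  by apply: Fm; [exact: iD|rewrite !ins_lift ler_pM2l].
- move=> x Dx k xk; rewrite mxE Fa; last 2 first.
  + exact: iD.
  + by rewrite ins_lift mulrC -ler_pdivlMr.
  by rewrite ins_lift; field; rewrite !gt_eqF.
Qed.

Lemma slice_tame_iso a a' j F F' : 0 < a < 1 -> 0 < a' < 1 ->
  tame_iso a a' F F' ->
  tame_iso (a / (1 - a)) (a' / (1 - a')) (slice a a' j F) (slice a' a j F').
Proof.
have H b b' G G' (x : 'rV[R]_n.+1) : 0 < b < 1 -> 0 < b' < 1 -> tame b b' G ->
    (forall x, simplex n.+1 x -> G' (G x) = x) ->
    simplex n x -> slice b' b j G' (slice b b' j G x) = x.
  move=> /andP[b0 b1] /andP[b'0 b'1] tG GK Dx.
  have iD : simplex n.+1 (ins b j x) by apply: ins_simplex; rewrite ?ltW.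
  rewrite {1}/slice ins_slice// ?ltW// ?GK// ?insK//.
  by apply: (tame_level _ tG) => //; rewrite ins_at.
move=> aP a'P [tF tF' FK F'K]; split.
- exact: slice_tame.
- exact: slice_tame.
- by move=> x; apply: H.
- by move=> x; apply: H.
Qed.

End SliceTheory.

(** * The map Lambda *)

Section Barycenter.
Context {R : realType} {n : nat}.
Implicit Types (x : 'rV[R]_n.+1).
Let b : R := n.+1%:R^-1.

Lemma sum_bary : \sum_(j < n.+1) b = 1.
Proof. by rewrite sumr_const card_ord -[LHS]mulr_natr mulVf// pnatr_eq0. Qed.

Lemma bary_gt0 : 0 < b.
Proof. by rewrite invr_gt0. Qed.

Lemma simplex_bary x : simplex n x -> (forall j, b <= x 0 j) -> x = const_mx b.
Proof.
move=> [_ x1] xb; apply/rowP => j; rewrite mxE; apply/eqP.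
rewrite -subr_eq0; apply/eqP.
apply: (@psumr_eq0P _ _ xpredT (fun j => x 0 j - b)) => //.
  by move=> i _; rewrite subr_ge0.
by rewrite big_split/= sumrN sum_bary x1 subrr.
Qed.

Lemma simplex_bary_le x : simplex n x -> (forall j, x 0 j <= b) -> x = const_mx b.
Proof.
move=> [_ x1] xb; apply/rowP => j; rewrite mxE; apply/eqP.
rewrite eq_sym -subr_eq0; apply/eqP.
apply: (@psumr_eq0P _ _ xpredT (fun j => b - x 0 j)) => //.
  by move=> i _; rewrite subr_ge0.
by rewrite big_split/= sumrN sum_bary x1 subrr.
Qed.

Lemma simplex_const : simplex n (const_mx b : 'rV[R]_n.+1).
Proof.
apply: simplexP => [j|]; first by rewrite mxE ltW// bary_gt0.
by under eq_bigr do rewrite mxE; exact: sum_bary.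
Qed.

(* Coordinates bounded below by 1/(n+1) in the limit are squeezed, as their sum is 1. *)
Lemma cvg_bary (T : Type) (F : set_system T) {FF : Filter F}
    (y : T -> 'rV[R]_n.+1) (g : 'I_n.+1 -> T -> R) :
  (forall j, g j t @[t --> F] --> b) ->
  (\forall t \near F, simplex n (y t)) ->
  (forall j, \forall t \near F, g j t <= y t 0 j) ->
  y t @[t --> F] --> const_mx b.
Proof.
move=> gb yD gy; apply/cvg_rowP => j; rewrite mxE.
apply: (@squeeze_cvgr _ _ _ _ (g j) (fun t => 1 - (\sum_i g i t - g j t))).
- have gy' : \forall t \near F, forall i, g i t <= y t 0 i by apply: filter_forall.
  apply: filterS2 yD gy' => t [_ y1] gyt; rewrite gyt/= -y1.
  rewrite (bigD1 j)//= [X in _ - (X - _)](bigD1 j)//= [X in _ - X]addrC addKr.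
  by rewrite -addrA lerDl subr_ge0 ler_sum.
- exact: gb.
- have -> : b = 1 - (\sum_(i < n.+1) b - b) by rewrite sum_bary opprB addrC subrK.
  apply: cvgB; first exact: cvg_cst.
  by apply: cvgB => //; apply: cvg_finsum.
Qed.

End Barycenter.

Section LambdaMap.
Context {R : realType} {n : nat}.
Implicit Types (x : 'rV[R]_n.+1).

Lemma tame_eq a a' (F G : 'rV[R]_n.+1 -> 'rV[R]_n.+1) :
  (forall x, simplex n x -> F x = G x) -> tame a a' F -> tame a a' G.
Proof.
move=> FG [FD Fc Fs Fm Fa]; split.
- by move=> x Dx /=; rewrite -FG//; exact: FD.
- apply: subspace_eq_continuous Fc => x; rewrite inE => Dx; exact: FG.
- by move=> s x Dx; rewrite -!FG//; [exact: Fs|exact: simplex_perm].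
- by move=> x Dx i j; rewrite -!FG//; exact: Fm.
- by move=> x Dx i; rewrite -!FG//; exact: Fa.
Qed.

Lemma tame_iso_eq a a' (F F' G G' : 'rV[R]_n.+1 -> 'rV[R]_n.+1) :
  (forall x, simplex n x -> F x = G x) -> (forall x, simplex n x -> F' x = G' x) ->
  tame_iso a a' F F' -> tame_iso a a' G G'.
Proof.
move=> FG FG' [tF tF' FK F'K]; split.
- exact: tame_eq tF.
- exact: tame_eq tF'.
- by move=> x Dx; rewrite -FG// -FG' ?FK//; case: tF => + _ _ _ _; apply.
- by move=> x Dx; rewrite -FG'// -FG ?F'K//; case: tF' => + _ _ _ _; apply.
Qed.

Let b : R := n.+1%:R^-1.

Definition shear (a a' : R) x : 'rV[R]_n.+1 :=
  \row_j (pl a a' b (lo b (x 0 j)) + hi b (x 0 j)).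

Definition lambda_pl (a a' : R) x := rescale b 1 (shear a a' x).

Section Bounds.
Variables (a a' : R).
Hypotheses (aP : 0 < a < b) (a'P : 0 < a' < b).

Lemma pl_lo_le t : pl a a' b (lo b t) <= b.
Proof. by rewrite -[leRHS](plb a' aP) pl_mono// lo_le. Qed.

Lemma lo_shear x j : lo b (shear a a' x 0 j) = pl a a' b (lo b (x 0 j)).
Proof.
rewrite mxE; have [xb|xb] := leP (x 0 j) b.
  by rewrite hi_le// addr0 lo_id// pl_lo_le.
by rewrite (lo_cut (ltW xb)) plb// lo_cut// lerDl hi_ge0.
Qed.

Lemma hi_shear x j : hi b (shear a a' x 0 j) = hi b (x 0 j).
Proof. by rewrite {1}/hi lo_shear mxE addrC addKr. Qed.

Lemma shear_mono x i j : x 0 i <= x 0 j -> shear a a' x 0 i <= shear a a' x 0 j.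
Proof. by move=> xij; rewrite !mxE lerD ?hi_mono// pl_mono// lo_mono. Qed.

Lemma shear_perm (s : 'S_n.+1) x : shear a a' (col_perm s x) = col_perm s (shear a a' x).
Proof. by apply/rowP => j; rewrite !mxE. Qed.

Lemma slope_shear x :
  slope b 1 (shear a a' x) =
  (\sum_j (b - pl a a' b (lo b (x 0 j)))) / \sum_j hi b (x 0 j).
Proof.
rewrite /slope -(@sum_bary R n) -sumrB; congr (_ / _).
  by apply: eq_bigr => j _; rewrite lo_shear.
by apply: eq_bigr => j _; rewrite hi_shear.
Qed.

Lemma slope_shear_ge0 x : 0 <= slope b 1 (shear a a' x).
Proof.
rewrite slope_shear divr_ge0 ?sumr_ge0// => j _; last exact: hi_ge0.
by rewrite subr_ge0 pl_lo_le.
Qed.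

Lemma sum_hi_neq0 x : simplex n x -> x != const_mx b -> 0 < \sum_j hi b (x 0 j).
Proof.
move=> Dx xb; rewrite lt_neqAle sumr_ge0 ?andbT; last by move=> j _; exact: hi_ge0.
apply: contra xb => /eqP/esym h0; apply/eqP; apply: simplex_bary_le => // j.
rewrite leNgt; apply/negP => xj.
have := psumr_eq0P (fun i _ => hi_ge0 b (x 0 i)) h0 (i := j) isT.
by rewrite hi_ge ?ltW// => /eqP; rewrite subr_eq0 gt_eqF.
Qed.

Lemma slope_shear_gt0 x : simplex n x -> x != const_mx b ->
  0 < slope b 1 (shear a a' x).
Proof.
move=> Dx xb; rewrite slope_shear divr_gt0//; last exact: sum_hi_neq0.
have pj j : 0 <= b - pl a a' b (lo b (x 0 j)) by rewrite subr_ge0 pl_lo_le.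
rewrite lt_neqAle sumr_ge0 ?andbT//.
apply: contra xb => /eqP/esym h0; apply/eqP; apply: simplex_bary => // j.
rewrite leNgt; apply/negP => xj.
have /eqP := psumr_eq0P (fun i _ => pj i) h0 (i := j) isT.
rewrite lo_id ?ltW// subr_eq0 gt_eqF// -[ltRHS](plb a' aP).
exact: pl_smono.
Qed.

Lemma shear_bary : shear a a' (const_mx b) = const_mx b.
Proof. by apply/rowP => j; rewrite !mxE lo_id// plb// hi_le// addr0. Qed.

Lemma lambda_pl_bary : lambda_pl a a' (const_mx b) = const_mx b.
Proof.
by rewrite /lambda_pl shear_bary; apply/rowP => j; rewrite rescale_small mxE.
Qed.

Lemma lambda_pl_ge x j : pl a a' b (lo b (x 0 j)) <= lambda_pl a a' x 0 j.
Proof. by rewrite -lo_shear rescale_ge// slope_shear_ge0. Qed.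

Lemma lambda_pl_simplex x : simplex n x -> simplex n (lambda_pl a a' x).
Proof.
move=> Dx; have [->|xb] := eqVneq x (const_mx b).
  by rewrite lambda_pl_bary; exact: simplex_const.
apply: simplexP => [j|].
  apply: le_trans (lambda_pl_ge x j).
  have a0 : 0 < a by case/andP: aP.
  rewrite -(pl0 a' b (ltW a0)) pl_mono// lo_ge0//.
    exact: ltW (@bary_gt0 R n).
  exact: simplex_ge0.
apply: rescale_sum; rewrite gt_eqF//; under eq_bigr do rewrite hi_shear.
exact: sum_hi_neq0.
Qed.

Lemma lambda_pl_continuous : {within simplex n, continuous (lambda_pl a a')}.
Proof.
apply/subspace_continuousP => x Dx.
have xx : y @[y --> within (simplex n) (nbhs x)] --> x by exact: cvg_within.
have xj j : (fun y : 'rV[R]_n.+1 => y 0 j) @ within (simplex n) (nbhs x) --> x 0 j.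
  by have /cvg_rowP := xx; exact.
have fj j : (fun y : 'rV[R]_n.+1 => pl a a' b (lo b (y 0 j))) @
    within (simplex n) (nbhs x) --> pl a a' b (lo b (x 0 j)).
  by apply: cvg_pl; apply: cvg_lo => //; exact: cvg_cst.
have [xb|xb] := eqVneq x (const_mx b).
  have Lx : lambda_pl a a' x = const_mx b by rewrite xb lambda_pl_bary.
  rewrite /from_subspace Lx.
  apply: (@cvg_bary _ _ _ _ _ _ (fun j (y : 'rV[R]_n.+1) => pl a a' b (lo b (y 0 j)))).
  - by move=> j; have := fj j; rewrite {2}xb mxE lo_id// plb.
  - by rewrite near_withinE; apply: nearW => y; exact: lambda_pl_simplex.
  - by move=> j; apply: nearW => y; exact: lambda_pl_ge.
apply: cvg_rescale.
- under eq_bigr do rewrite hi_shear; rewrite gt_eqF//; exact: sum_hi_neq0.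
- exact: cvg_cst.
- exact: cvg_cst.
- apply/cvg_rowP => j; under eq_fun do rewrite mxE; rewrite mxE.
  by apply: cvgD => //; apply: cvg_hi => //; exact: cvg_cst.
Qed.

Lemma lambda_pl_tame : tame a a' (lambda_pl a a').
Proof.
split.
- exact: lambda_pl_simplex.
- exact: lambda_pl_continuous.
- by move=> s x Dx; rewrite /lambda_pl shear_perm rescale_perm.
- move=> x Dx i j xij; apply: rescale_mono; first exact: slope_shear_ge0.
  exact: shear_mono.
- move=> x Dx j xa; have xb : x 0 j <= b.
    by apply: le_trans xa _; apply: ltW; case/andP: aP.
  have sE : shear a a' x 0 j = a' / a * x 0 j.
    by rewrite mxE hi_le// addr0 lo_id// pl_small.
  rewrite /lambda_pl rescale_small// mxE hi_le// addr0 pl_lo_le//.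
Qed.

End Bounds.

Lemma lambda_plK a a' x : 0 < a < b -> 0 < a' < b -> simplex n x ->
  lambda_pl a' a (lambda_pl a a' x) = x.
Proof.
move=> aP a'P Dx; have [->|xb] := eqVneq x (const_mx b).
  by rewrite !lambda_pl_bary.
have s0 := slope_shear_gt0 aP a'P Dx xb.
pose lam := slope b 1 (shear a a' x).
pose sigma := \sum_j (lo b (x 0 j) + lam * hi b (x 0 j)).
have h0 := sum_hi_neq0 Dx xb.
have sl : slope b sigma x = lam.
  by rewrite /slope /sigma big_split/= -mulr_sumr addrAC subrr add0r mulfK ?gt_eqF.
have zE : shear a' a (lambda_pl a a' x) = rescale b sigma x.
  apply/rowP => j.
  have yE : lambda_pl a a' x 0 j =
      lo b (shear a a' x 0 j) + lam * hi b (shear a a' x 0 j) by rewrite mxE.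
  rewrite [LHS]mxE [RHS]mxE yE sl lo_glue ?hi_glue ?(ltW s0)//.
  by rewrite lo_shear// plK// hi_shear.
rewrite /lambda_pl zE rescaleK ?sl//.
by case: Dx => _ <-; exact: rescale_id.
Qed.

Lemma lambda_pl_iso a a' : 0 < a < b -> 0 < a' < b ->
  tame_iso a a' (lambda_pl a a') (lambda_pl a' a).
Proof.
move=> aP a'P; split; try exact: lambda_pl_tame.
  by move=> x; exact: lambda_plK.
by move=> x; exact: lambda_plK.
Qed.

End LambdaMap.

Section LambdaChoice.
Context {R : realType} {n : nat}.
Implicit Types (x : 'rV[R]_n.+1).
Let b : R := n.+1%:R^-1.

Lemma sorted_by_ex x : exists s, sorted_by s x.
Proof.
pose le i j := x 0 i <= x 0 j.
have le_tot : total le by move=> i j; exact: le_total.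
have le_tr : transitive le by move=> i j k; exact: le_trans.
have /tuple_permP[s sE] : perm_eq (sort le (ord_tuple n.+1)) (ord_tuple n.+1).
  by rewrite perm_sort.
exists s; apply/forallP => i; apply/forallP => j; apply/implyP => ij.
have := sort_sorted le_tot (ord_tuple n.+1); rewrite sE => srt.
have nthE (k : 'I_n.+1) : nth i [tuple tnth (ord_tuple n.+1) (s k) | k < n.+1] k = s k.
  by rewrite -tnth_nth tnth_mktuple tnth_ord_tuple.
have := sorted_leq_nth le_tr (fun k => lexx (x 0 k)) i srt.
move=> /(_ i j); rewrite !inE !size_tuple !ltn_ord => /(_ isT isT ij).
by rewrite /le !nthE.
Qed.

Lemma Lambda_choice_ex x : simplex n x -> exists sr, Lambda_choice x sr.
Proof.
move=> Dx; have [s sx] := sorted_by_ex x.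
have [i xi] : exists i, x 0 (s i) <= b.
  have [/existsP//|/existsPn xb] := boolP [exists i, x 0 (s i) <= b].
  have xb' : x = const_mx b.
    by apply: simplex_bary => // j; have := xb ((s^-1)%g j); rewrite permKV -ltNge => /ltW.
  by have := xb ord0; rewrite xb' mxE lexx.
pose r := [arg max_(k > i | x 0 (s k) <= b) (k : nat)].
exists (s, r); rewrite /Lambda_choice/= sx/= /r.
case: arg_maxnP => // k xk kmax; rewrite xk/=.
apply/forallP => l; apply/implyP => kl; rewrite ltNge.
by apply/negP => /kmax; rewrite /geq/= leqNgt kl.
Qed.

Lemma Lambda_choice_le x s r k : Lambda_choice x (s, r) ->
  (x 0 (s k) <= b) = (k <= r)%N.
Proof.
move=> /and3P[/= sx xr /forallP rx]; have [kr|kr] := leqP k r.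
  apply: le_trans xr; have /forallP/(_ r)/implyP := forallP sx k; exact.
by have /implyP/(_ kr) := rx k; rewrite ltNge => /negbTE.
Qed.

Lemma LambdaE (a a' : R) x : 0 < a < b -> 0 < a' < b -> simplex n x ->
  Lambda n (pl a a' b) x = lambda_pl a a' x.
Proof.
move=> aP a'P Dx; rewrite /Lambda; case: pickP => [[s r] srx|no]; last first.
  by have [sr] := Lambda_choice_ex Dx; rewrite no.
have xE := Lambda_choice_le _ srx; apply/rowP => j.
rewrite [RHS]mxE lo_shear// hi_shear// slope_shear// mxE.
have -> : ((s^-1)%g j <= r)%N = (x 0 j <= b) by rewrite -xE permKV.
have -> : \sum_(i < n.+1 | (i <= r)%N) (x 0 (s i) - pl a a' b (x 0 (s i))) =
    \sum_i (lo b (x 0 i) - pl a a' b (lo b (x 0 i))).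
  rewrite [RHS](reindex_inj (@perm_inj _ s))/= big_mkcond/=; apply: eq_bigr => i _.
  rewrite -xE; case: leP => xi; first by rewrite lo_id.
  by rewrite lo_cut ?ltW// plb// subrr.
have -> : \sum_(i < n.+1 | (r < i)%N) (x 0 (s i) - n.+1%:R^-1) =
    \sum_i hi b (x 0 i).
  rewrite [RHS](reindex_inj (@perm_inj _ s))/= big_mkcond/=; apply: eq_bigr => i _.
  rewrite ltnNge -xE; case: leP => xi /=; first by rewrite hi_le.
  by rewrite hi_ge// ltW.
have [xj|xj] := leP (x 0 j) b; first by rewrite hi_le// mulr0 addr0 lo_id.
have h0 : \sum_i hi b (x 0 i) != 0.
  rewrite gt_eqF// (bigD1 j)//= ltr_wpDr ?sumr_ge0 ?hi_ge ?subr_gt0// ?ltW//.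
  by move=> i _; exact: hi_ge0.
have loE : \sum_i lo b (x 0 i) = 1 - \sum_i hi b (x 0 i).
  by case: Dx => _ <-; rewrite -sumrB; apply: eq_bigr => i _; rewrite opprB addrC subrK.
rewrite hi_ge ?ltW// lo_cut ?ltW// plb//.
move: (\sum_i hi b (x 0 i)) h0 loE => H h0 loE.
rewrite !sumrB sum_bary loE -/b; by field.
Qed.

End LambdaChoice.

Lemma phi0E (R : realType) n :
  @phi0 R n = pl (2 * n.+1%:R)^-1 (2 * n.+2%:R)^-1 n.+1%:R^-1.
Proof.
apply/funext => t; rewrite /phi0 /line_through /=.
have a0 : 0 < (2 * n.+1%:R)^-1 :> R by rewrite invr_gt0 mulr_gt0.
case: leP => ta; first by rewrite pl_small// !subr0 add0r.
by rewrite pl_big ?gt_eqF// ltW.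
Qed.

(** * Extension from the boundary *)

Section Minor.
Context {R : realType} {n : nat}.
Implicit Types (x : 'rV[R]_n.+1) (j : 'I_n.+1).

Definition least x j := [forall k, x 0 j <= x 0 k].

Lemma leastP x j : reflect (forall k, x 0 j <= x 0 k) (least x j).
Proof. exact: forallP. Qed.

Definition argleast x := [arg min_(j < ord0) x 0 j]%O.

Lemma argleastP x : least x (argleast x).
Proof. by apply/leastP; rewrite /argleast; case: arg_minP => // j _ jx k; exact: jx. Qed.

Lemma least_eq x i j : least x i -> least x j -> x 0 i = x 0 j.
Proof. by move=> /leastP xi /leastP xj; apply/eqP; rewrite eq_le xi xj. Qed.

Lemma cvg_least (V : topologicalType) (f : 'rV[R]_n.+1 -> V) (A : set 'rV[R]_n.+1) x :
  (forall j, least x j -> f @ within (A `&` [set y | least y j]) (nbhs x) --> f x) ->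
  f @ within A (nbhs x) --> f x.
Proof.
move=> fx P fP; rewrite /= /nbhs/= /within/=.
have H : \forall y \near nbhs x, forall j, A y -> least y j -> P (f y).
  apply: filter_forall => j; have [xj|/forallPn[k]] := boolP (least x j).
    have := fx j xj P fP; rewrite /= /nbhs/= /within/=; apply: filterS => y H Ay yj.
    exact: H.
  rewrite -ltNge -subr_gt0 => xkj.
  have c : (fun y : 'rV[R]_n.+1 => y 0 j - y 0 k) @ nbhs x --> x 0 j - x 0 k.
    have xi i : (fun y : 'rV[R]_n.+1 => y 0 i) @ nbhs x --> x 0 i.
      exact: (@coord_continuous R 1 n.+1 0 i x).
    exact: cvgB (xi j) (xi k).
  have H : nbhs x [set y : 'rV[R]_n.+1 | 0 < y 0 j - y 0 k] by exact: (cvgr_gt _ c).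
  apply: filterS H => y /=; rewrite subr_gt0 => ykj _ /leastP/(_ k).
  by rewrite leNgt ykj.
by apply: filterS H => y /(_ (argleast y)) H Ay; apply: H => //; exact: argleastP.
Qed.

End Minor.

Section Face.
Context {R : realType} {n : nat}.
Implicit Types (z : 'rV[R]_n.+2) (i j k : 'I_n.+2) (G : 'rV[R]_n.+1 -> 'rV[R]_n.+1).

Definition face G j z : 'rV[R]_n.+2 := ins 0 j (G (rem 0 j z)).

Lemma face_at G j z : face G j z 0 j = 0.
Proof. exact: ins_at. Qed.

Lemma face_ins G j x : face G j (ins 0 j x) = ins 0 j (G x).
Proof. by rewrite /face insK// ltr01. Qed.

Variables (a a' : R) (G : 'rV[R]_n.+1 -> 'rV[R]_n.+1).
Hypotheses (a0 : 0 < a) (tG : tame a a' G).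

Lemma face_simplex j z : simplex n.+1 z -> z 0 j = 0 -> simplex n.+1 (face G j z).
Proof.
move=> Dz zj; apply: ins_simplex; first by rewrite lexx ltr01.
by case: tG => + _ _ _ _; apply; apply: rem_simplex.
Qed.

Lemma face_small j k z : simplex n.+1 z -> z 0 j = 0 -> z 0 k <= a ->
  face G j z 0 k = a' / a * z 0 k.
Proof.
move=> Dz zj; case: (unliftP j k) => [l|] ->; last by rewrite ins_at zj mulr0.
move=> zl; rewrite ins_lift subr0 mul1r.
case: tG => _ _ _ _ ->; rewrite ?mxE ?subr0 ?invr1 ?mul1r//.
exact: rem_simplex.
Qed.

Lemma face_mono j k l z : simplex n.+1 z -> z 0 j = 0 ->
  z 0 k <= z 0 l -> face G j z 0 k <= face G j z 0 l.
Proof.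
move=> Dz zj zkl; have w0 i : 0 <= face G j z 0 i.
  exact: simplex_ge0 (face_simplex Dz zj).
case: (unliftP j k) => [k'|] kE; last by rewrite kE ins_at.
case: (unliftP j l) => [l'|] lE; last first.
  have zk : z 0 k = 0.
    by apply/eqP; rewrite eq_le simplex_ge0// andbT (le_trans zkl)// lE zj.
  by rewrite face_small// zk ?mulr0// ltW.
rewrite kE lE !ins_lift subr0 !mul1r.
case: tG => _ _ _ + _; apply; first exact: rem_simplex.
by rewrite !mxE subr0 invr1 !mul1r -kE -lE.
Qed.

Lemma face_perm (s : 'S_n.+2) k z : simplex n.+1 z -> z 0 (s k) = 0 ->
  face G k (col_perm s z) = col_perm s (face G (s k) z).
Proof.
move=> Dz zk; have [t st] := lift_perm_surj s k.
rewrite /face; have -> : rem 0 k (col_perm s z) = col_perm t (rem 0 (s k) z).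
  by rewrite {1}st rem_perm.
case: tG => _ _ Gs _ _; rewrite Gs; last exact: rem_simplex.
by rewrite (ins_perm 0 k (s k)) -st.
Qed.

Lemma face_index j k z : simplex n.+1 z -> z 0 j = 0 -> z 0 k = 0 ->
  face G j z = face G k z.
Proof.
move=> Dz zj zk; have zs : z = col_perm (tperm j k) z.
  by apply/rowP => i; rewrite mxE; case: tpermP => [->|->|]; rewrite ?zj ?zk.
rewrite [in RHS]zs face_perm ?tpermR//.
apply/rowP => i; rewrite [RHS]mxE.
have wk : face G j z 0 k = 0 by rewrite face_small// ?zk ?mulr0// ltW.
by case: tpermP => [->|->|]; rewrite ?wk ?face_at.
Qed.

End Face.

Section Extension.
Context {R : realType} {n : nat}.
Implicit Types (x w : 'rV[R]_n.+2) (i j k : 'I_n.+2) (m : R).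
Let b : R := n.+2%:R^-1.

Definition core (a : R) x j : 'rV[R]_n.+2 :=
  rescale (hi (x 0 j) a) 1 (x - const_mx (x 0 j)).

Definition raise (a m : R) w : 'rV[R]_n.+2 :=
  const_mx m + rescale (hi m a) (1 - n.+2%:R * m) w.

Definition ext_at (a a' : R) (G : 'rV[R]_n.+1 -> 'rV[R]_n.+1) j x :=
  raise a' (pl a a' b (x 0 j)) (face G j (core a x j)).

Definition ext (a a' : R) (G : 'rV[R]_n.+1 -> 'rV[R]_n.+1) x :=
  if b <= x 0 (argleast x) then x else ext_at a a' G (argleast x) x.

Lemma sum_const m : \sum_(k < n.+2) m = n.+2%:R * m.
Proof. by rewrite sumr_const card_ord mulr_natl. Qed.

Lemma least_bary x j : simplex n.+1 x -> least x j -> b <= x 0 j -> x = const_mx b.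
Proof. by move=> Dx /leastP xj bx; apply: simplex_bary => // k; exact: le_trans (xj k). Qed.

Lemma ext_bary a a' G : ext a a' G (const_mx b) = const_mx b.
Proof. by rewrite /ext mxE lexx. Qed.

Section Slopes.
Variables (a m : R).
Hypotheses (aP : 0 < a < b) (m0 : 0 <= m) (mb : m < b).

Lemma deficit_le1 : 1 - n.+2%:R * m <= 1.
Proof. by rewrite gerBl mulr_ge0. Qed.

Lemma sum_lo_lt w : \sum_k lo (hi m a) (w 0 k) < 1 - n.+2%:R * m.
Proof.
apply: (@le_lt_trans _ _ (n.+2%:R * hi m a)).
  by rewrite -sum_const; apply: ler_sum => k _; exact: lo_le.
rewrite ltrBrDr -mulrDr mulrC -ltr_pdivlMr// div1r.
have /andP[_ ab] := aP; have [am|ma] := leP a m; first by rewrite hi_le// add0r.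
by rewrite hi_ge ?ltW// subrK.
Qed.

Lemma sum_hi_gt0 w : 1 - n.+2%:R * m <= \sum_k w 0 k ->
  0 < \sum_k hi (hi m a) (w 0 k).
Proof.
move=> w1; rewrite sumrB subr_gt0; exact: lt_le_trans (sum_lo_lt w) w1.
Qed.

Lemma slope_gt0 w sigma : 1 - n.+2%:R * m <= \sum_k w 0 k ->
  1 - n.+2%:R * m <= sigma -> 0 < slope (hi m a) sigma w.
Proof.
move=> w1 s1; rewrite divr_gt0// ?sum_hi_gt0// subr_gt0.
exact: lt_le_trans (sum_lo_lt w) s1.
Qed.

End Slopes.

Section Core.
Variables (a : R) (x : 'rV[R]_n.+2) (j : 'I_n.+2).
Hypotheses (aP : 0 < a < b) (Dx : simplex n.+1 x) (xj : least x j) (xb : x 0 j < b).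
Let m := x 0 j.

Let m0 : 0 <= m. Proof. exact: simplex_ge0. Qed.

Lemma sum_shift : \sum_k (x - const_mx m) 0 k = 1 - n.+2%:R * m.
Proof.
under eq_bigr do rewrite !mxE.
by rewrite sumrB sum_const; case: Dx => _ ->.
Qed.

Lemma slope_core : 0 < slope (hi m a) 1 (x - const_mx m).
Proof. by apply: slope_gt0 => //; rewrite ?sum_shift// deficit_le1. Qed.

Lemma core_at : core a x j 0 j = 0.
Proof. by rewrite /core rescale_small !mxE subrr// hi_ge0. Qed.

Lemma core_mono k l : x 0 k <= x 0 l -> core a x j 0 k <= core a x j 0 l.
Proof.
move=> xkl; apply: rescale_mono; first exact: ltW slope_core.
by rewrite !mxE lerB.
Qed.

Lemma core_simplex : simplex n.+1 (core a x j).
Proof.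
apply: simplexP => [k|].
  by rewrite -core_at; apply: core_mono; exact/leastP.
by apply: rescale_sum; rewrite gt_eqF// sum_hi_gt0// sum_shift.
Qed.

Lemma core_small k : x 0 k <= a -> core a x j 0 k = x 0 k - m.
Proof.
move=> xk; rewrite /core rescale_small !mxE// -/m.
by have /leastP/(_ k) mk := xj; rewrite hi_ge ?lerB// (le_trans mk).
Qed.

Lemma raise_core : raise a m (core a x j) = x.
Proof.
rewrite /raise /core rescaleK; last exact: slope_core.
by rewrite -sum_shift rescale_id addrC subrK.
Qed.

End Core.

Section Raise.
Variables (a m : R) (w : 'rV[R]_n.+2).
Hypotheses (aP : 0 < a < b) (m0 : 0 <= m) (mb : m < b) (Dw : simplex n.+1 w).

Let w1 : 1 - n.+2%:R * m <= \sum_k w 0 k.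
Proof. by case: Dw => _ ->; exact: deficit_le1. Qed.

Lemma slope_raise : 0 < slope (hi m a) (1 - n.+2%:R * m) w.
Proof. exact: slope_gt0. Qed.

Lemma raise_ge k : m <= raise a m w 0 k.
Proof.
rewrite mxE [X in X + _]mxE lerDl; apply: le_trans (rescale_ge _ (ltW slope_raise)).
by rewrite lo_ge0 ?hi_ge0//; exact: simplex_ge0.
Qed.

Lemma raise_small k : w 0 k <= hi m a -> raise a m w 0 k = m + w 0 k.
Proof. by move=> wk; rewrite mxE [X in X + _]mxE rescale_small. Qed.

Lemma raise_mono k l : w 0 k <= w 0 l -> raise a m w 0 k <= raise a m w 0 l.
Proof.
move=> wkl; rewrite mxE [X in X + _]mxE [leRHS]mxE [X in _ <= X + _]mxE lerD2l.
by apply: rescale_mono => //; exact: ltW slope_raise.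
Qed.

Lemma raise_simplex : simplex n.+1 (raise a m w).
Proof.
apply: simplexP => [k|]; first exact: le_trans (raise_ge k).
under eq_bigr do rewrite mxE [X in X + _]mxE.
rewrite big_split/= sum_const rescale_sum; first by rewrite addrC subrK.
by rewrite gt_eqF// sum_hi_gt0.
Qed.

Lemma core_raise j : w 0 j = 0 -> raise a m w 0 j = m /\ core a (raise a m w) j = w.
Proof.
move=> wj; have rj : raise a m w 0 j = m by rewrite raise_small wj ?addr0 ?hi_ge0.
split=> //; rewrite /core rj /raise addrC addrA addNr add0r.
by rewrite rescaleK ?slope_raise//; case: Dw => _ <-; exact: rescale_id.
Qed.

End Raise.

End Extension.

Lemma near_coord_lt (R : realType) n (x : 'rV[R]_n) j c :
  x 0 j < c -> nbhs x [set y : 'rV[R]_n | y 0 j < c].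
Proof.
move=> xc; have xj : (fun y : 'rV[R]_n => y 0 j) @ nbhs x --> x 0 j.
  exact: (@coord_continuous R 1 n 0 j x).
exact: (cvgr_lt _ xj).
Qed.

Section ExtensionTheory.
Context {R : realType} {n : nat}.
Implicit Types (x : 'rV[R]_n.+2) (i j k : 'I_n.+2).
Let b : R := n.+2%:R^-1.

Lemma hi_pl (a a' : R) m : 0 < a < b -> 0 < a' < b ->
  hi (pl a a' b m) a' = a' / a * hi m a.
Proof.
move=> aP a'P; have /andP[a0 ab] := aP; have ha : a' / a * a = a' by rewrite divfK// gt_eqF.
have [am|ma] := leP a m.
  rewrite [in RHS]hi_le// mulr0 hi_le// -[leLHS]ha -(pl_small a' b (lexx a)).
  exact: pl_mono.
rewrite [in RHS]hi_ge ?ltW// pl_small ?ltW// hi_ge ?mulrBr ?ha//.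
by rewrite -[leRHS]ha ler_pM2l ?ltW// divr_gt0//; case/andP: a'P.
Qed.

Section Forward.
Variables (a a' : R) (G : 'rV[R]_n.+1 -> 'rV[R]_n.+1).
Hypotheses (aP : 0 < a < b) (a'P : 0 < a' < b) (tG : tame a a' G).

Let a0 : 0 < a. Proof. by case/andP: aP. Qed.
Let a'0 : 0 < a'. Proof. by case/andP: a'P. Qed.

Lemma pl_ge0 t : 0 <= t -> 0 <= pl a a' b t.
Proof. by move=> t0; rewrite -(pl0 a' b (ltW a0)) pl_mono. Qed.

Lemma pl_lt t : t < b -> pl a a' b t < b.
Proof. by move=> tb; rewrite -[ltRHS](plb a' aP) pl_smono. Qed.

Lemma ext_at_index j k x : simplex n.+1 x -> least x j -> least x k -> x 0 j < b ->
  ext_at a a' G j x = ext_at a a' G k x.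
Proof.
move=> Dx xj xk xb; have xjk := least_eq xj xk.
have cE : core a x j = core a x k by rewrite /core xjk.
rewrite /ext_at xjk cE (face_index a0 tG (j := j) (k := k))//.
- by rewrite -cE; exact: core_simplex.
- by rewrite -cE core_at.
- by rewrite core_at.
Qed.

Lemma extE j x : simplex n.+1 x -> least x j -> x 0 j < b ->
  ext a a' G x = ext_at a a' G j x.
Proof.
move=> Dx xj xb; have al := argleastP x.
rewrite /ext (least_eq al xj) leNgt xb/=; apply: ext_at_index => //.
by rewrite (least_eq al xj).
Qed.

Lemma ext_cases x : simplex n.+1 x ->
  x = const_mx b \/ exists j, least x j /\ x 0 j < b.
Proof.
move=> Dx; have al := argleastP x; have [bx|xb] := leP b (x 0 (argleast x)).
  by left; exact: least_bary bx.
by right; exists (argleast x).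
Qed.

Section At.
Variables (x : 'rV[R]_n.+2) (j : 'I_n.+2).
Hypotheses (Dx : simplex n.+1 x) (xj : least x j) (xb : x 0 j < b).

Let m0 : 0 <= pl a a' b (x 0 j). Proof. by apply: pl_ge0; exact: simplex_ge0. Qed.
Let mb : pl a a' b (x 0 j) < b. Proof. exact: pl_lt. Qed.
Let Dz : simplex n.+1 (core a x j). Proof. exact: core_simplex. Qed.
Let zj : core a x j 0 j = 0. Proof. exact: core_at. Qed.
Let Dw : simplex n.+1 (face G j (core a x j)).
Proof. exact: (face_simplex tG). Qed.

Lemma ext_at_simplex : simplex n.+1 (ext_at a a' G j x).
Proof. exact: raise_simplex. Qed.

Lemma ext_at_ge k : pl a a' b (x 0 j) <= ext_at a a' G j x 0 k.
Proof. exact: raise_ge. Qed.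

Lemma ext_at_min : ext_at a a' G j x 0 j = pl a a' b (x 0 j).
Proof. by have [] := core_raise a'P m0 mb Dw (face_at G j _). Qed.

Lemma core_ext_at : core a' (ext_at a a' G j x) j = face G j (core a x j).
Proof. by have [] := core_raise a'P m0 mb Dw (face_at G j _). Qed.

Lemma ext_at_least : least (ext_at a a' G j x) j.
Proof. by apply/leastP => k; rewrite ext_at_min; exact: ext_at_ge. Qed.

Lemma ext_at_mono k l : x 0 k <= x 0 l -> ext_at a a' G j x 0 k <= ext_at a a' G j x 0 l.
Proof.
move=> xkl; apply: raise_mono => //; apply: (face_mono a0 tG) => //.
exact: core_mono.
Qed.

Lemma ext_at_small k : x 0 k <= a -> ext_at a a' G j x 0 k = a' / a * x 0 k.
Proof.
move=> xk; have /leastP/(_ k) mk := xj; have ma := le_trans mk xk.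
have zk : core a x j 0 k = x 0 k - x 0 j by exact: core_small.
have wk : face G j (core a x j) 0 k = a' / a * (x 0 k - x 0 j).
  rewrite (face_small tG)// zk// (le_trans _ xk)// gerBl; exact: simplex_ge0.
rewrite /ext_at raise_small wk; first by rewrite pl_small// mulrBr addrC subrK.
by rewrite hi_pl// hi_ge// ler_pM2l ?divr_gt0// lerB.
Qed.

End At.

Lemma ext_simplex x : simplex n.+1 x -> simplex n.+1 (ext a a' G x).
Proof.
move=> Dx; have [->|[j [xj xb]]] := ext_cases Dx.
  by rewrite ext_bary; exact: simplex_const.
by rewrite (extE Dx xj)//; exact: ext_at_simplex.
Qed.

Lemma ext_ge x j k : simplex n.+1 x -> least x j -> pl a a' b (x 0 j) <= ext a a' G x 0 k.
Proof.
move=> Dx xj; have [xb|bx] := ltP (x 0 j) b.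
  by rewrite (extE Dx xj)//; exact: ext_at_ge.
have xE := least_bary Dx xj bx.
by rewrite [in leRHS]xE ext_bary xE !mxE plb.
Qed.

Lemma ext_face j u : simplex n u -> ext a a' G (ins 0 j u) = ins 0 j (G u).
Proof.
move=> Du; have D : simplex n.+1 (ins 0 j u).
  by apply: ins_simplex => //; rewrite lexx ltr01.
have l : least (ins 0 j u) j.
  by apply/leastP => k; rewrite ins_at; exact: simplex_ge0.
have b0 : 0 < b by rewrite invr_gt0.
rewrite (extE D l) ?ins_at//.
have cE : core a (ins 0 j u) j = ins 0 j u.
  rewrite /core ins_at subr0; case: D => _ <-; exact: rescale_id.
rewrite /ext_at cE face_ins ins_at pl0 ?ltW// /raise mulr0 subr0 add0r.
have [_ <-] : simplex n.+1 (ins 0 j (G u)).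
  apply: ins_simplex; first by rewrite lexx ltr01.
  by case: tG => + _ _ _ _; apply.
exact: rescale_id.
Qed.

Lemma ext_at_perm (s : 'S_n.+2) k x :
  simplex n.+1 x -> least x (s k) -> x 0 (s k) < b ->
  ext_at a a' G k (col_perm s x) = col_perm s (ext_at a a' G (s k) x).
Proof.
move=> Dx xk xb; rewrite /ext_at.
have xkE : col_perm s x 0 k = x 0 (s k) by rewrite mxE.
have const_perm m : const_mx m = col_perm s (const_mx m : 'rV[R]_n.+2).
  by apply/rowP => i; rewrite !mxE.
have -> : core a (col_perm s x) k = col_perm s (core a x (s k)).
  rewrite /core xkE -rescale_perm; congr rescale.
  by apply/rowP => i; rewrite !mxE.
rewrite (face_perm tG) ?core_at//; last exact: core_simplex.
rewrite xkE /raise rescale_perm [in LHS]const_perm.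
by apply/rowP => i; rewrite !mxE.
Qed.

Lemma ext_perm : respects_permutations (ext a a' G).
Proof.
move=> s x Dx; have [xE|[j [xj xb]]] := ext_cases Dx.
  have -> : col_perm s x = x by rewrite xE; apply/rowP => i; rewrite !mxE.
  by rewrite xE ext_bary; apply/rowP => i; rewrite !mxE.
have jE : j = s ((s^-1)%g j) by rewrite permKV.
rewrite (extE Dx xj)// jE -ext_at_perm -?jE//; apply: extE.
- exact: simplex_perm.
- by apply/leastP => k; rewrite !mxE -jE; exact/leastP.
- by rewrite mxE -jE.
Qed.

Lemma ext_at_cvg j x : simplex n.+1 x -> least x j -> x 0 j < b ->
  ext_at a a' G j @ within (simplex n.+1 `&` [set y | least y j]) (nbhs x) -->
    ext_at a a' G j x.
Proof.
move=> Dx xj xb.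
set F := within _ _.
have xx : id @ F --> x by exact: cvg_within.
have yi i : (fun y : 'rV[R]_n.+2 => y 0 i) @ F --> x 0 i.
  by have /cvg_rowP := xx; exact.
have yc (f : 'rV[R]_n.+2 -> R) l : f @ F --> l ->
    (fun y => const_mx (f y) : 'rV[R]_n.+2) @ F --> (const_mx l : 'rV[R]_n.+2).
  by move=> fl; apply/cvg_rowP => i; under eq_fun do rewrite mxE; rewrite mxE.
have nearD : \forall y \near F, [/\ simplex n.+1 y, least y j & y 0 j < b].
  have H := near_coord_lt xb.
  by apply: filterS H => y yb [Dy yj].
have core_cvg : (fun y => core a y j) @ F --> core a x j.
  apply: cvg_rescale.
  - by rewrite gt_eqF// sum_hi_gt0// sum_shift.
  - by apply: cvg_hi => //; exact: cvg_cst.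
  - exact: cvg_cst.
  - by apply: cvgB => //; exact: yc.
have m_cvg : (fun y : 'rV[R]_n.+2 => pl a a' b (y 0 j)) @ F --> pl a a' b (x 0 j).
  exact: cvg_pl.
have m'0 : 0 <= pl a a' b (x 0 j) by apply: pl_ge0; exact: simplex_ge0.
have Dz : simplex n.+1 (core a x j) by exact: core_simplex.
apply: cvgD; first exact: yc.
apply: cvg_rescale.
- rewrite gt_eqF// sum_hi_gt0//; first exact: pl_lt.
  have [_ ->] : simplex n.+1 (face G j (core a x j)).
    by apply: (face_simplex tG) => //; exact: core_at.
  exact: deficit_le1.
- by apply: cvg_hi => //; exact: cvg_cst.
- by apply: cvgB; [exact: cvg_cst|apply: cvgM => //; exact: cvg_cst].
- apply: cvg_ins; have [_ Gc _ _ _] := tG.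
  apply: (cvg_withincomp Gc).
  + by apply: rem_simplex => //; exact: core_at.
  + apply: filterS nearD => y [Dy yj yb].
    by apply: rem_simplex => //; [exact: core_at|exact: core_simplex].
  + exact: cvg_rem.
Qed.

Lemma ext_continuous : {within simplex n.+1, continuous (ext a a' G)}.
Proof.
apply/subspace_continuousP => x Dx; apply: cvg_least => j xj.
have [xb|bx] := ltP (x 0 j) b.
  rewrite [X in _ --> X](extE Dx xj)//.
  have H := near_coord_lt xb.
  apply: cvg_trans (ext_at_cvg Dx xj xb); apply: near_eq_cvg.
  rewrite near_withinE; apply: filterS H => y yb [Dy yj].
  by rewrite /from_subspace (extE Dy yj).
have xE := least_bary Dx xj bx.
have fx : ext a a' G x = const_mx b by rewrite xE ext_bary.
rewrite /from_subspace fx.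
apply: (@cvg_bary _ _ _ _ _ _ (fun _ (y : 'rV[R]_n.+2) => pl a a' b (y 0 j))).
- move=> _; have -> : n.+2%:R^-1 = pl a a' b (x 0 j) by rewrite xE mxE plb.
  apply: cvg_pl.
  have xx : id @ within (simplex n.+1 `&` [set y | least y j]) (nbhs x) --> x.
    exact: cvg_within.
  by have /cvg_rowP := xx; exact.
- by rewrite near_withinE; apply: nearW => y [Dy _]; exact: ext_simplex.
- by move=> k; rewrite near_withinE; apply: nearW => y [Dy yj]; exact: ext_ge.
Qed.

Lemma ext_tame : tame a a' (ext a a' G).
Proof.
split.
- exact: ext_simplex.
- exact: ext_continuous.
- exact: ext_perm.
- move=> x Dx k l xkl; have [->|[j [xj xb]]] := ext_cases Dx.
    by rewrite ext_bary !mxE.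
  by rewrite !(extE Dx xj)//; exact: ext_at_mono.
- move=> x Dx k xk; have [xE|[j [xj xb]]] := ext_cases Dx.
    by move: xk; rewrite xE mxE leNgt; case/andP: aP => _ ->.
  by rewrite !(extE Dx xj)//; exact: ext_at_small.
Qed.

End Forward.

Lemma extK (a a' : R) (G G' : 'rV[R]_n.+1 -> 'rV[R]_n.+1) x : 0 < a < b -> 0 < a' < b ->
  tame a a' G -> tame a' a G' -> (forall u, simplex n u -> G' (G u) = u) ->
  simplex n.+1 x -> ext a' a G' (ext a a' G x) = x.
Proof.
move=> aP a'P tG tG' GK Dx; have [->|[j [xj xb]]] := ext_cases Dx.
  by rewrite !ext_bary.
have yj := ext_at_min aP a'P tG Dx xj xb.
rewrite (extE aP tG Dx xj)// (extE a'P tG' (j := j)); first last.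
- by rewrite yj; exact: pl_lt.
- exact: ext_at_least.
- exact: ext_at_simplex.
have Dz : simplex n.+1 (core a x j) by exact: core_simplex.
have zj : core a x j 0 j = 0 by exact: core_at.
rewrite {1}/ext_at core_ext_at// yj plK// {1}/face /face insK// GK; last exact: rem_simplex.
by rewrite remK//; exact: raise_core.
Qed.

Lemma ext_iso (a a' : R) (G G' : 'rV[R]_n.+1 -> 'rV[R]_n.+1) : 0 < a < b -> 0 < a' < b ->
  tame_iso a a' G G' -> tame_iso a a' (ext a a' G) (ext a' a G').
Proof.
move=> aP a'P [tG tG' GK G'K]; split; try exact: ext_tame.
- by move=> x; exact: extK.
- by move=> x; exact: extK.
Qed.

End ExtensionTheory.

(** * The maps Theta *)

Lemma ins_ins (R : realType) n (u u' w w' : R) (j p : 'I_n.+2) (x : 'rV[R]_n.+1) :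
  (j <= p)%N -> u = (1 - u') * w' -> u' = (1 - u) * w ->
  ins u (widen_ord (leqnSn n.+2) j) (ins w p x) = ins u' (lift ord0 p) (ins w' j x).
Proof.
move=> jp uE u'E; set j' := widen_ord _ j.
have pE : lift j' p = lift ord0 p by apply: val_inj; rewrite /= /bump jp.
have jE : lift (lift ord0 p) j = j'.
  by apply: val_inj; rewrite /= /bump/= leqNgt ltnS jp.
apply/rowP => k; case: (unliftP j' k) => [k'|] ->; last first.
  by rewrite ins_at -jE ins_lift ins_at.
rewrite ins_lift; case: (unliftP p k') => [l|] ->.
  have -> : lift j' (lift p l) = lift (lift ord0 p) (lift j l).
    by apply: val_inj; rewrite /= /bump /=; lia.
  by rewrite !ins_lift mulrA mulrA; congr (_ * _); rewrite !mulrBr !mulr1 -u'E -uE; lra.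
by rewrite ins_at pE ins_at.
Qed.

Section Construction.
Context {R : realType}.

Definition lvl n : R := (2 * n.+1%:R)^-1.
Definition lvl1 n : R := (2 * n.+1%:R + 1)^-1.

Lemma lvl_bounds n : 0 < lvl n < n.+1%:R^-1.
Proof.
rewrite /lvl invr_gt0 mulr_gt0//= ltf_pV2 ?posrE ?mulr_gt0//.
by rewrite mulrC ltr_pMr// ltr1n.
Qed.

Lemma lvlS_bounds n : 0 < lvl n.+1 < n.+1%:R^-1.
Proof.
have /andP[-> l] := lvl_bounds n.+1; apply: lt_trans l _.
by rewrite ltf_pV2 ?posrE// ltr_nat.
Qed.

Lemma lvl1_bounds n : 0 < lvl1 n < n.+1%:R^-1.
Proof.
rewrite /lvl1 invr_gt0 addr_gt0//= ltf_pV2 ?posrE ?addr_gt0// -natrM natr1 ltr_nat.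
lia.
Qed.

Lemma invn_le1 n : n.+1%:R^-1 <= 1 :> R.
Proof. by rewrite invf_le1// ler1n. Qed.

Lemma lvl1E n : lvl n.+1 / (1 - lvl n.+1) = lvl1 n.
Proof.
rewrite /lvl /lvl1 -[n.+2%:R]natr1.
have n0 : 0 <= n.+1%:R :> R by [].
move: n.+1%:R n0 => t t0; field.
by rewrite !gt_eqF//; lra.
Qed.

Definition theta0 n : 'rV[R]_n.+1 -> 'rV[R]_n.+1 :=
  if n == 0%N then id else Lambda n (phi0 n).

Definition theta0_inv n : 'rV[R]_n.+1 -> 'rV[R]_n.+1 :=
  if n == 0%N then id else lambda_pl (lvl n.+1) (lvl n).

Lemma Lambda_phi0_iso n :
  tame_iso (lvl n) (lvl n.+1) (Lambda n (phi0 n)) (lambda_pl (lvl n.+1) (lvl n)).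
Proof.
apply: tame_iso_eq (lambda_pl_iso (lvl_bounds n) (lvlS_bounds n)) => // x Dx.
by rewrite phi0E LambdaE ?lvl_bounds ?lvlS_bounds.
Qed.

Lemma theta0_iso n : tame_iso (lvl n) (lvl n.+1) (@theta0 n) (@theta0_inv n).
Proof.
rewrite /theta0 /theta0_inv; case: n => [|n] /=; last exact: Lambda_phi0_iso.
apply: tame_iso_id0.
  by have /andP[_] := lvl_bounds 0; rewrite invr1.
by have /andP[_] := lvlS_bounds 0; rewrite invr1.
Qed.

Definition theta_link n : 'rV[R]_n.+1 -> 'rV[R]_n.+1 :=
  slice (lvl n.+1) (lvl n.+2) ord0 (@theta0 n.+1).

Fixpoint theta1 n : 'rV[R]_n.+1 -> 'rV[R]_n.+1 :=
  match n with
  | 0 => id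
  | m.+1 => ext (lvl m.+1) (lvl1 m.+1) (@theta_link m \o @theta1 m \o @theta0_inv m)
  end.

Lemma lvl_lt1 n : 0 < lvl n < 1.
Proof. by have /andP[-> /lt_le_trans->] := lvl_bounds n; rewrite ?invn_le1. Qed.

Lemma lvl1_lt1 n : 0 < lvl1 n < 1.
Proof. by have /andP[-> /lt_le_trans->] := lvl1_bounds n; rewrite ?invn_le1. Qed.

Lemma theta_link_iso n : exists F, tame_iso (lvl1 n) (lvl1 n.+1) (@theta_link n) F.
Proof.
exists (slice (lvl n.+2) (lvl n.+1) ord0 (@theta0_inv n.+1)).
by rewrite -!lvl1E; apply: slice_tame_iso (theta0_iso _); exact: lvl_lt1.
Qed.

Lemma theta1_step n F : tame_iso (lvl n) (lvl1 n) (@theta1 n) F ->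
  exists H, tame_iso (lvl n.+1) (lvl1 n.+1)
    (@theta_link n \o @theta1 n \o @theta0_inv n) H.
Proof.
move=> tF; have [L tL] := theta_link_iso n.
have p0 k : 0 < lvl k by case/andP: (lvl_lt1 k).
have p1 k : 0 < lvl1 k by case/andP: (lvl1_lt1 k).
eexists; apply: (tame_iso_comp (b := lvl n)) => //.
  exact: tame_iso_sym (theta0_iso n).
exact: (tame_iso_comp (b := lvl1 n)) tF tL.
Qed.

Lemma theta1_iso n : exists F, tame_iso (lvl n) (lvl1 n) (@theta1 n) F.
Proof.
elim: n => [|n [F /theta1_step[H tH]]].
  exists id; apply: tame_iso_id0; first by case/andP: (lvl_lt1 0).
  by case/andP: (lvl1_lt1 0).
by eexists; apply: ext_iso tH; [exact: lvl_bounds|exact: lvl1_bounds].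
Qed.

Lemma theta1_face n j (x : 'rV[R]_n.+1) : simplex n x ->
  theta1 (ins 0 j (theta0 x)) = ins 0 j (theta_link (theta1 x)).
Proof.
move=> Dx; have [F /theta1_step[H [tH _ _ _]]] := theta1_iso n.
have [[D _ _ _ _] _ K _] := theta0_iso n.
by rewrite /= ext_face ?lvl_bounds ?lvl1_bounds//= ?K//; exact: D.
Qed.

End Construction.

Section Identities.
Context {R : realType} {m : nat}.

Definition inserted n (i : bool) : R := i%:R / (2 * n.+1%:R).

(* Value taken by theta i in dimension m.+1 on a coordinate equal to inserted m.+1 k. *)
Definition image_level (i k : bool) : R :=
  if k then (if i then lvl1 m.+1 else lvl m.+2) else 0.

Definition theta n (i : bool) : 'rV[R]_n.+1 -> 'rV[R]_n.+1 :=
  if i then @theta1 R n else @theta0 R n.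

Lemma inserted_lt1 n i : 0 <= inserted n i < 1.
Proof.
rewrite /inserted; case: i; last by rewrite mul0r lexx ltr01.
by rewrite mul1r; have /andP[/ltW -> ->] := @lvl_lt1 R n.
Qed.

Lemma image_level_lt1 i k : image_level i k < 1.
Proof.
rewrite /image_level; case: k => //; case: i.
  by case/andP: (@lvl1_lt1 R m.+1).
by case/andP: (@lvl_lt1 R m.+2).
Qed.

Lemma image_levelE i k : inserted m.+2 i = (1 - inserted m.+2 k) * image_level k i.
Proof.
rewrite /inserted /image_level; case: i; case: k; rewrite ?mul0r ?subr0 ?mulr0 ?mul1r//.
rewrite /lvl1 -[m.+3%:R]natr1.
have n0 : 0 <= m.+2%:R :> R by [].
move: m.+2%:R n0 => t t0; field.
by rewrite !gt_eqF//; lra.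
Qed.

Lemma theta_tame n i : exists c, tame (lvl n) c (@theta n i).
Proof.
case: i; first by have [F [tF _ _ _]] := @theta1_iso R n; exists (lvl1 n).
by have [tF _ _ _] := @theta0_iso R n; exists (lvl n.+1).
Qed.

Lemma theta_simplex n i x : simplex n x -> simplex n (theta i x).
Proof. by have [c [D _ _ _ _]] := theta_tame n i; apply: D. Qed.

Lemma theta_inserted i k p (x : 'rV[R]_m.+1) : simplex m x ->
  theta i (ins (inserted m.+1 k) p x) 0 p = image_level i k.
Proof.
move=> Dx; have Di := ins_simplex p (inserted_lt1 m.+1 k) Dx.
have l0 : 0 < lvl m.+1 :> R by case/andP: (@lvl_lt1 R m.+1).
have at_p := ins_at (inserted m.+1 k) p x.
case: k Di at_p => Di at_p.
  have {}at_p : ins (inserted m.+1 true) p x 0 p = lvl m.+1.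
    by rewrite at_p /inserted mul1r.
  case: i; first by have [F [tF _ _ _]] := @theta1_iso R m.+1; apply: (tame_level l0 tF).
  by have [tF _ _ _] := @theta0_iso R m.+1; apply: (tame_level l0 tF).
have [c tF] := theta_tame m.+1 i.
by apply: (tame_zero (ltW l0) tF) => //; rewrite at_p /inserted mul0r.
Qed.

Lemma theta_exchange i k (x : 'rV[R]_m.+1) : simplex m x ->
  slice (inserted m.+1 k) (image_level i k) ord0 (@theta m.+1 i) (theta k x) =
  slice (inserted m.+1 i) (image_level k i) ord0 (@theta m.+1 k) (theta i x).
Proof.
have H : forall x, simplex m x ->
    slice (inserted m.+1 false) (image_level true false) ord0 (@theta m.+1 true)
      (theta false x) =
    slice (inserted m.+1 true) (image_level false true) ord0 (@theta m.+1 false)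
      (theta true x).
  move=> {}x Dx; rewrite /slice /inserted mul0r mul1r.
  rewrite -[theta false x]/(theta0 x) -[@theta m.+1 true]/(@theta1 R m.+1).
  by rewrite theta1_face// insK// ltr01.
by case: i; case: k => // Dx; rewrite H.
Qed.

Lemma theta_square i k (j p : 'I_m.+2) (x : 'rV[R]_m.+1) : (j <= p)%N -> simplex m x ->
  ins (inserted m.+2 i) (widen_ord (leqnSn m.+2) j)
    (theta i (ins (inserted m.+1 k) p (theta k x))) =
  ins (inserted m.+2 k) (lift ord0 p)
    (theta k (ins (inserted m.+1 i) j (theta i x))).
Proof.
move=> jp Dx.
have E i' k' q : theta i' (ins (inserted m.+1 k') q (theta k' x)) =
    ins (image_level i' k') q
      (slice (inserted m.+1 k') (image_level i' k') ord0 (@theta m.+1 i') (theta k' x)).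
  have Dk := theta_simplex k' Dx.
  have [c [_ _ Fs _ _]] := theta_tame m.+1 i'.
  rewrite (slice_index _ ord0 q)//; last exact: inserted_lt1.
  by rewrite ins_slice ?image_level_lt1// theta_inserted.
rewrite (E i k p) (E k i j) theta_exchange//.
by apply: ins_ins => //; exact: image_levelE.
Qed.

End Identities.

(* World: MathComp-Analysis. The index n >= 1 of the paper is m.+1 below. *)
Theorem theorem2 (R : realType) :
  exists Theta1 : forall n : nat, 'rV[R]_n.+1 -> 'rV[R]_n.+1,
    let Th := Theta Theta1 in
    [/\ forall n : nat, (1 <= n)%N -> comfort (Theta1 n),
        forall n : nat, (1 <= n)%N -> comfort (Lambda n (@phi0 R n))
      & forall m : nat,
        (forall (i k : bool) (j p : 'I_m.+2), (j <= p)%N ->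
           {in simplex m,
              insert_coord m.+2 i (widen_ord (leqnSn m.+2) j) \o Th m.+1 i
                \o insert_coord m.+1 k p \o Th m k
              =1
              insert_coord m.+2 k (lift ord0 p) \o Th m.+1 k
                \o insert_coord m.+1 i j \o Th m i}) /\
        homeomorphism_on (cross m.+1 (2 * m.+2%:R)^-1)
          (cross m.+1 (2 * m.+2%:R + 1)^-1) (Th m.+1 true)].
Proof.
exists (@theta1 R) => Th.
have ThE n i : Th n i = @theta R n i.
  by rewrite /Th /Theta /theta /theta0; case: n => [|n]; case: i.
split=> [n _|n _|m].
- by have [F tF] := @theta1_iso R n; exact: tame_iso_comfort tF.
- exact: tame_iso_comfort (Lambda_phi0_iso n).
split=> [i k j p jp x|].
  by rewrite inE => Dx; rewrite !ThE; exact: theta_square.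
have [F tF] := @theta1_iso R m.+1; apply: tame_iso_cross tF.
  by case/andP: (@lvl_lt1 R m.+1).
by case/andP: (@lvl1_lt1 R m.+1).
Qed.
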